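(* Let $Q\in\mathbb{R}^{n\times n}$ be symmetric, $b\in\mathbb{R}^n$, and let $Q=U\Lambda U^T$ be an eigenvalue decomposition, where $\Lambda=\mathrm{diag}(\lambda_1,\dots,\lambda_n)$ with $\lambda_1=\cdots=\lambda_m<\lambda_{m+1}\le\cdots\le\lambda_n$, and $U=[u_1,\dots,u_n]\in\mathbb{R}^{n\times n}$ is orthogonal. Suppose $\lambda_1<0$. Then the problem $$\min_{(x,z)\in\mathbb{R}^{n+1}}\{x^TQx+2z\,b^Tx:\ x^Tx\le 1,\ z^2=1\}$$ has a strict global minimizer at which the standard second-order sufficient optimality condition does not hold if and only if $b^Tu_i=0$ for $i=1,\dots,m$ and $$\sum_{j=m+1}^n\left(\frac{u_j^Tb}{\lambda_j-\lambda_1}\right)^2=1.$$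
   Context: Write $w=(x^T,z)^T\in\mathbb{R}^{n+1}$ and $$A_0=\begin{bmatrix} Q & b \\ {b^T} & 0 \end{bmatrix},\quad A_1=\begin{bmatrix} 0 & 0 \\ 0 & 1 \end{bmatrix},\quad A_2=\begin{bmatrix} I & 0 \\ 0 & 0 \end{bmatrix},$$ so the problem is $\min\{w^TA_0w: w^TA_1w=1,\ w^TA_2w\le 1\}$. The standard second-order sufficient optimality condition at a feasible point $w^*$ is: $w^{*T}A_2w^*=1$ and there exist $\alpha\in\mathbb{R}$, $\beta>0$ such that $(A_0+\alpha A_1+\beta A_2)w^*=0$ and $v^T(A_0+\alpha A_1+\beta A_2)v>0$ for all $v\ne0$ with $v^TA_1w^*=0$ and $v^TA_2w^*=0$. Since $w$ and $-w$ always have the same objective value, a strict global minimizer means a global minimizer that is also a strict local minimizer (its objective value is strictly smaller than that of all other feasible points in some neighbourhood). Here $m\ge1$ is the multiplicity of the smallest eigenvalue $\lambda_1$; if $m=n$ the sum is empty and equals $0$. *)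

(* Defs.v *)
From HB Require Import structures.
From mathcomp Require Import all_boot all_order all_algebra.
From mathcomp Require Import all_classical all_reals all_analysis.
Set Implicit Arguments.
Unset Strict Implicit.
Unset Printing Implicit Defensive.
Import Order.TTheory GRing.Theory Num.Theory.
Import numFieldNormedType.Exports.
Local Open Scope classical_set_scope.
Local Open Scope ring_scope.

Definition global_minimizer (R : realType) (T : Type)
    (F : set T) (f : T -> R) (p : T) : Prop :=
  F p /\ forall q, F q -> f p <= f q.

Definition strict_local_minimizer (R : realType) (T : topologicalType)
    (F : set T) (f : T -> R) (p : T) : Prop :=
  F p /\ \forall q \near p, F q -> q <> p -> f p < f q.

(* Not "strictly better than every other feasible point": in the problem below
   w and - w always have the same objective value. *)
Definition strict_global_minimizer (R : realType) (T : topologicalType)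
    (F : set T) (f : T -> R) (p : T) : Prop :=
  global_minimizer F f p /\ strict_local_minimizer F f p.

(* 1 x 1 matrices are read as scalars through their (0, 0) entry. *)
Definition bilin (R : realType) (n : nat) (M : 'M[R]_n) (u v : 'cV[R]_n) : R :=
  (u^T *m M *m v) 0 0.

Definition dot (R : realType) (n : nat) (u v : 'cV[R]_n) : R :=
  (u^T *m v) 0 0.

Definition tr_objective (R : realType) (n : nat) (Q : 'M[R]_n) (b : 'cV[R]_n)
    (p : 'cV[R]_n * R) : R :=
  bilin Q p.1 p.1 + 2 * p.2 * dot b p.1.

Definition tr_feasible (R : realType) (n : nat) : set ('cV[R]_n * R) :=
  [set p | dot p.1 p.1 <= 1 /\ p.2 ^+ 2 = 1].

Definition A0 (R : realType) (n : nat) (Q : 'M[R]_n) (b : 'cV[R]_n) :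
    'M[R]_(n + 1) := block_mx Q b b^T 0.

Definition A1 (R : realType) (n : nat) : 'M[R]_(n + 1) := block_mx 0 0 0 1%:M.

Definition A2 (R : realType) (n : nat) : 'M[R]_(n + 1) := block_mx 1%:M 0 0 0.

Definition stack (R : realType) (n : nat) (p : 'cV[R]_n * R) : 'cV[R]_(n + 1) :=
  col_mx p.1 p.2%:M.

(* Second-order sufficient condition at a feasible point p, with multipliers
   alpha for w^T A1 w = 1 and beta for the active constraint w^T A2 w <= 1. *)
Definition sosc (R : realType) (n : nat) (Q : 'M[R]_n) (b : 'cV[R]_n)
    (p : 'cV[R]_n * R) : Prop :=
  let w := stack p in
  bilin (A2 R n) w w = 1 /\
  exists alpha beta : R,
    let H := A0 Q b + alpha *: A1 R n + beta *: A2 R n in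
    [/\ 0 < beta, H *m w = 0 &
        forall v : 'cV[R]_(n + 1), v != 0 ->
          bilin (A1 R n) v w = 0 -> bilin (A2 R n) v w = 0 -> 0 < bilin H v v].

(* Main.v *)
Require Import Defs.
From HB Require Import structures.
From mathcomp Require Import all_boot all_order all_algebra.
From mathcomp Require Import all_classical all_reals all_analysis.
From mathcomp Require Import ring lra.
Import Order.TTheory GRing.Theory Num.Theory.
Import numFieldNormedType.Exports.
(** Why the equivalence holds.  Let E be the eigenspace of the smallest
    eigenvalue l = lambda_1 < 0.

    Everything rests on one identity, [tr_objectiveD_multiplier]: if
    (Q + beta I) x = - z b, then
      f(x + d, z) - f(x, z)
        = d^T (Q + beta I) d + beta (|x|^2 - |x + d|^2).
    So a multiplier beta >= 0 with Q + beta I positive semidefinite makes x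
    globally optimal on the sphere, and conversely the global minimizers have
    such a multiplier ([multiplier_exists]): a reflection of x in an arbitrary
    hyperplane stays on the sphere, and comparing f at x and at its mirror image
    gives both stationarity and semidefiniteness.  Negative curvature (l < 0)
    keeps minimizers away from the interior of the ball
    ([global_minimizer_on_sphere]).

    At a global minimizer therefore |x| = 1 and beta >= - l > 0.  By [soscP] the
    second-order condition says that Q + beta I is positive definite on the
    hyperplane orthogonal to x.  Its failure gives u <> 0 orthogonal to x in the
    kernel of Q + beta I, which forces beta = - l (the degenerate or hard case)
    and u in E.  If x had a nonzero component along some e in E, then the
    reflections of x along u + t e, for t -> 0+, would be other minimizers
    converging to x ([not_strict_local_minimizer]), and strictness would fail.
    So x is orthogonal to E, and reading (Q - l I) x = - z b in the eigenbasis
    gives b orthogonal to E and x_j = - z b_j / (lambda_j - l) for the other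
    coordinates; the sum condition is |x|^2 = 1.

    Conversely, under the two conditions on b these coordinates define a unit
    vector y orthogonal to E with (Q - l I) y = - b.  The identity with
    beta = - l shows that y is optimal for z = 1 and that another minimizer
    y + d has d in E and |y + d| = |y|; as y is orthogonal to E, d = 0.  The
    second-order condition fails at y in the direction u_1. *)

Set Implicit Arguments.
Unset Strict Implicit.
Unset Printing Implicit Defensive.
Local Open Scope classical_set_scope.
Local Open Scope ring_scope.

(** * Inner product, objective and reflections *)

Section Dot.
Context (R : realType) (n : nat).
Implicit Types (u v w x d b : 'cV[R]_n) (Q : 'M[R]_n).

Lemma dotE u v : dot u v = \sum_j u j 0 * v j 0.
Proof. by rewrite /dot mxE; apply: eq_bigr => j _; rewrite mxE. Qed.

Lemma dotC u v : dot u v = dot v u.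
Proof. by rewrite !dotE; apply: eq_bigr => j _; rewrite mulrC. Qed.

Lemma dotDr u v w : dot u (v + w) = dot u v + dot u w.
Proof. by rewrite /dot mulmxDr mxE. Qed.

Lemma dotZr a u v : dot u (a *: v) = a * dot u v.
Proof. by rewrite /dot -scalemxAr mxE. Qed.

Lemma dotNr u v : dot u (- v) = - dot u v.
Proof. by rewrite -scaleN1r dotZr mulN1r. Qed.

Lemma dotDl u v w : dot (v + w) u = dot v u + dot w u.
Proof. by rewrite dotC dotDr !(dotC u). Qed.

Lemma dotZl a u v : dot (a *: v) u = a * dot v u.
Proof. by rewrite dotC dotZr dotC. Qed.

Lemma dotNl u v : dot (- v) u = - dot v u.
Proof. by rewrite dotC dotNr dotC. Qed.

Lemma dot0l u : dot 0 u = 0.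
Proof. by rewrite -(scale0r 0) dotZl mul0r. Qed.

Lemma dot0r u : dot u 0 = 0.
Proof. by rewrite dotC dot0l. Qed.

Lemma dot_ge0 u : 0 <= dot u u.
Proof. by rewrite dotE sumr_ge0 // => j _; rewrite -expr2 sqr_ge0. Qed.

Lemma dot_eq0 u : (dot u u == 0) = (u == 0).
Proof.
apply/idP/eqP => [|->]; last by rewrite dot0l.
rewrite dotE psumr_eq0 => [/allP h|j _]; last by rewrite -expr2 sqr_ge0.
apply/matrixP => j k; rewrite (ord1 k) mxE.
by apply/eqP; have := h j (mem_index_enum j); rewrite /= mulf_eq0 orbb.
Qed.

Lemma dot_gt0 u : (0 < dot u u) = (u != 0).
Proof. by rewrite lt0r dot_eq0 dot_ge0 andbT. Qed.

Lemma bilinE Q u v : bilin Q u v = dot u (Q *m v).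
Proof. by rewrite /bilin /dot mulmxA. Qed.

Lemma dot_mulmx_sym Q u v : Q^T = Q -> dot u (Q *m v) = dot v (Q *m u).
Proof.
by move=> hQ; rewrite [LHS]dotC /dot trmx_mul hQ mulmxA.
Qed.

Lemma tr_objectiveD Q b x d z : Q^T = Q ->
  tr_objective Q b (x + d, z) =
  tr_objective Q b (x, z) + 2 * dot (Q *m x + z *: b) d + dot d (Q *m d).
Proof.
move=> hQ; rewrite /tr_objective /= !bilinE mulmxDr !(dotDl, dotDr, dotZl).
rewrite (dot_mulmx_sym x d hQ) (dotC (Q *m x) d); ring.
Qed.

(** Stationarity on the sphere turns the linear term of the Taylor expansion
    into a difference of squared norms, since
    2 x^T d = |x + d|^2 - |x|^2 - |d|^2. *)
Lemma tr_objectiveD_multiplier Q b x d z beta : Q^T = Q ->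
  Q *m x + z *: b = - beta *: x ->
  tr_objective Q b (x + d, z) = tr_objective Q b (x, z)
    + (dot d (Q *m d) + beta * dot d d)
    + beta * (dot x x - dot (x + d) (x + d)).
Proof.
move=> hQ hx; rewrite tr_objectiveD // hx !(dotDl, dotDr, dotZl).
rewrite (dotC d x); ring.
Qed.

(** This symmetry reduces the component z = - 1 of the feasible set to z = 1. *)
Lemma tr_objectiveN Q b x z : tr_objective Q b (- x, - z) = tr_objective Q b (x, z).
Proof.
rewrite /tr_objective /= !bilinE mulmxN !(dotNr, dotNl); ring.
Qed.

(** The mirror image of [x] in the hyperplane orthogonal to [w]: it moves along
    the sphere as a rational function of [w], so minimality there becomes a
    polynomial inequality. *)
Definition reflection x w := x + (- 2 * (dot x w / dot w w)) *: w.

Lemma dot_reflection x w : w != 0 ->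
  dot (reflection x w) (reflection x w) = dot x x.
Proof.
rewrite -dot_gt0 => /lt0r_neq0 hw.
by rewrite /reflection !(dotDl, dotDr, dotZl, dotZr) (dotC w x); field.
Qed.

End Dot.

(** * The second-order condition without block matrices *)

Section Sosc.
Context (R : realType) (n : nat).
Implicit Types (Q : 'M[R]_n) (b x : 'cV[R]_n) (z : R).

(** The multiplier alpha of the constraint z^2 = 1 is determined by the last
    row of H w = 0, and the condition v^T A1 w = 0 kills the last component of
    v because z <> 0.  Only x, beta and the directions orthogonal to x
    remain. *)
Lemma soscP Q b x z : z ^+ 2 = 1 ->
  sosc Q b (x, z) <->
  dot x x = 1 /\ exists beta, [/\ 0 < beta, Q *m x + z *: b = - beta *: x &
    forall u, u != 0 -> dot u x = 0 -> 0 < dot u (Q *m u) + beta * dot u u].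
Proof.
move=> hz.
have hdot (u y : 'cV[R]_n) (s t : R) :
    dot (col_mx u s%:M) (col_mx y t%:M) = dot u y + s * t.
  rewrite /dot tr_col_mx mul_row_col tr_scalar_mx -scalar_mxM mxE.
  by rewrite [X in _ + X]mxE eqxx mulr1n.
have hA2 (u y : 'cV[R]_n) (s t : R) :
    bilin (A2 R n) (col_mx u s%:M) (col_mx y t%:M) = dot u y.
  rewrite bilinE /A2 mul_block_col !(mul1mx, mul0mx, addr0).
  have -> : 0 = (0 : R)%:M :> 'cV[R]_1 by rewrite raddf0.
  by rewrite hdot mulr0 addr0.
have hA1 (u y : 'cV[R]_n) (s t : R) :
    bilin (A1 R n) (col_mx u s%:M) (col_mx y t%:M) = s * t.
  rewrite bilinE /A1 mul_block_col !(mul1mx, mul0mx, addr0, add0r).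
  by rewrite hdot dot0r add0r.
have hH (alpha beta : R) (u : 'cV[R]_n) (s : R) :
    (A0 Q b + alpha *: A1 R n + beta *: A2 R n) *m col_mx u s%:M =
    col_mx (Q *m u + s *: b + beta *: u) (dot b u + alpha * s)%:M.
  rewrite /A0 /A1 /A2 !scale_block_mx !add_block_mx mul_block_col.
  rewrite !scaler0 !addr0 !add0r; congr col_mx.
    rewrite mulmxDl -scalemxAl mul1mx mul_mx_scalar addrAC //.
  rewrite -scalemxAl mul1mx scale_scalar_mx raddfD /=; congr (_ + _).
  by rewrite /dot -mx11_scalar.
rewrite /sosc /stack /= hA2; split=> -[hx].
  move=> [alpha [beta [hb]]]; rewrite hH => hw hpos; split=> //.
  exists beta; split=> //.
    have : Q *m x + z *: b + beta *: x = 0.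
      by have := congr1 usubmx hw; rewrite col_mxKu linear0.
    by move/eqP; rewrite addr_eq0 scaleNr => /eqP.
  move=> u hu hux; have := hpos (col_mx u 0%:M).
  rewrite hA1 hA2 mul0r bilinE hH scale0r addr0 mulr0 addr0.
  rewrite hdot mul0r addr0 dotDr dotZr; apply => //.
  apply: contra_neq hu => hu.
  by have := congr1 usubmx hu; rewrite col_mxKu linear0.
move=> [beta [hb hw hpos]]; split=> //.
(* The last row of H w = 0 reads b^T x + alpha z = 0, and 1 / z = z. *)
exists (- z * dot b x), beta; split=> //.
  rewrite hH hw scaleNr addNr.
  have -> : dot b x + - z * dot b x * z = (1 - z ^+ 2) * dot b x by ring.
  by rewrite hz subrr mul0r raddf0 col_mx0.
move=> v; rewrite -[v]vsubmxK [dsubmx v]mx11_scalar.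
move: (usubmx v) (dsubmx v 0 0) => u s hv.
rewrite hA1 hA2 => hs hux.
have s0 : s = 0.
  move/eqP: hs; rewrite mulf_eq0 => /orP[/eqP//|/eqP z0].
  by move: hz; rewrite z0 expr0n /= => /eqP; rewrite eq_sym oner_eq0.
move: hv; rewrite s0 => hv.
rewrite bilinE hH scale0r addr0 mulr0 addr0.
rewrite hdot mul0r addr0 dotDr dotZr; apply: hpos => //.
by apply: contra_neq hv => ->; rewrite raddf0 col_mx0.
Qed.

End Sosc.

(** * Necessary conditions at a global minimizer *)

(** An inequality between polynomials in t > 0 passes to the limit t -> 0;
    degree 3 covers the perturbations used for [multiplier_exists]. *)
Lemma poly3_ge0_at0 (R : realType) (a b c d : R) :
  (forall t, 0 < t -> 0 <= a + t * (b + t * (c + t * d))) -> 0 <= a.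
Proof.
move=> h; rewrite leNgt; apply/negP => a0.
pose K := `|b| + `|c| + `|d| + 1 - a.
have hb := ler_norm b; have hc := ler_norm c; have hd := ler_norm d.
have nb := normr_ge0 b; have nc := normr_ge0 c; have nd := normr_ge0 d.
have K0 : 0 < K by rewrite /K; lra.
pose t := - a / K.
have t0 : 0 < t by rewrite /t divr_gt0 // oppr_gt0.
have t1 : t < 1 by rewrite /t ltr_pdivrMr // /K; lra.
have tK : t * K = - a by rewrite /t divfK // gt_eqF.
have := h t t0.
suff : t * (b + t * (c + t * d)) < t * K by lra.
rewrite ltr_pM2l // /K.
have hle X B : X <= B -> 0 <= B -> t * X <= B.
  move=> XB B0; apply: le_trans (ler_wpM2l (ltW t0) XB) _.
  by rewrite ler_piMl // ltW.
have : t * (c + t * d) <= `|c| + `|d|.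
  by apply: (hle); [apply: lerD => //; apply: hle | rewrite addr_ge0].
by lra.
Qed.

Section NecessaryConditions.
Context (R : realType) (n : nat).
Variables (Q : 'M[R]_n) (b x : 'cV[R]_n) (z : R).
Hypotheses (hQ : Q^T = Q)
  (hmin : global_minimizer (@tr_feasible R n) (tr_objective Q b) (x, z)).

Let hz : z ^+ 2 = 1. Proof. by case: hmin => -[]. Qed.

Lemma global_minimizer_step d : dot (x + d) (x + d) <= 1 ->
  0 <= 2 * dot (Q *m x + z *: b) d + dot d (Q *m d).
Proof.
move=> hd; have [_ /(_ (x + d, z))] := hmin.
rewrite tr_objectiveD // => h.
have : tr_feasible (x + d, z) by split.
by move/h; lra.
Qed.

(** From an interior point one can step by + t and by - t along an eigenvector
    of negative curvature: the first-order terms cancel in the sum of the two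
    increments, which is 2 t^2 l < 0, so one of the steps decreases f. *)
Lemma global_minimizer_on_sphere u l : l < 0 -> dot u u = 1 ->
  Q *m u = l *: u -> dot x x = 1.
Proof.
move=> l0 hu hQu; have [[/= hx _] _] := hmin.
apply/eqP; rewrite eq_le hx leNgt; apply/negP => hx1.
(* As t <= 1 and |x^T u| <= 1, |x + s u|^2 <= |x|^2 + 2 t + t^2
   <= |x|^2 + 3 t = 1 for s = t and s = - t. *)
pose t := (1 - dot x x) / 3.
have t0 : 0 < t by rewrite /t; lra.
have t1 : t <= 1 by rewrite /t; have := dot_ge0 x; lra.
have hxu : dot x u ^+ 2 <= 1.
  have := dot_ge0 (x - dot x u *: u).
  rewrite !(dotDl, dotDr, dotZl, dotZr, dotNl, dotNr) hu (dotC u x).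
  by move=> h; rewrite expr2; lra.
have hstep s : s ^+ 2 = t ^+ 2 ->
    0 <= 2 * s * dot (Q *m x + z *: b) u + t ^+ 2 * l.
  move=> hs; have hsxu : s * dot x u <= t.
    rewrite -(ler_pM2l t0).
    have : t ^+ 2 * dot x u ^+ 2 <= t ^+ 2 by rewrite ler_piMr // sqr_ge0.
    by have := sqr_ge0 (s - t * dot x u); rewrite sqrrB exprMn hs mulr2n; lra.
  have := global_minimizer_step (d := s *: u).
  move: (Q *m x + z *: b) => g.
  rewrite -scalemxAr hQu !(dotDl, dotDr, dotZl, dotZr) hu (dotC u x).
  have -> : 2 * (s * dot g u) + s * (s * (l * 1)) =
            2 * s * dot g u + t ^+ 2 * l by rewrite -hs; ring.
  apply.
  have : s * (s * 1) <= t.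
    by rewrite mulr1 -expr2 hs expr2 ler_piMr // ltW.
  have : 3 * t = 1 - dot x x by rewrite /t; field.
  by lra.
have t2l : t ^+ 2 * l < 0 by rewrite nmulr_llt0 // exprn_gt0.
have := hstep t erefl; have := hstep (- t) (sqrrN t).
by lra.
Qed.

(** Let g be half the gradient and s = x^T w.  The reflected point is
    x - 2 s / |w|^2 w, so minimality reads s^2 w^T Q w >= s (g^T w) |w|^2.  Let
    h be the component of g tangent to the sphere at x.  Taking w = h + t x,
    dividing by t and letting t -> 0+ gives - |h|^4 >= 0, hence
    g = - beta x.  The inequality then reads
    s^2 w^T (Q + beta I) w >= 0, and the case s = 0 follows by perturbing w
    into w + t x. *)
Lemma multiplier_exists : dot x x = 1 ->
  exists2 beta, Q *m x + z *: b = - beta *: x &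
    forall w, 0 <= dot w (Q *m w) + beta * dot w w.
Proof.
move=> hx; set g := Q *m x + z *: b.
(* Minimality at the reflected point, with the denominators cleared. *)
have hrefl w : 0 <= dot x w ^+ 2 * dot w (Q *m w) - dot x w * dot g w * dot w w.
  have [->|w0] := eqVneq w 0; first by rewrite !dot0r !dot0l; lra.
  have := global_minimizer_step (d := (- 2 * (dot x w / dot w w)) *: w).
  rewrite -/(reflection x w) dot_reflection // hx lexx => /(_ isT).
  rewrite -scalemxAr !(dotZl, dotZr) -/g => h.
  have ww : dot w w != 0 by rewrite dot_eq0.
  have : 0 <= dot w w ^+ 2 / 4 * (2 * (- 2 * (dot x w / dot w w) * dot g w) +
    - 2 * (dot x w / dot w w) *
      (- 2 * (dot x w / dot w w) * dot w (Q *m w))).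
    by rewrite mulr_ge0 // divr_ge0 // sqr_ge0.
  by congr (0 <= _); field.
clearbody g.
pose beta := - dot g x; pose h := g + beta *: x.
have hxh : dot x h = 0.
  by rewrite /h dotDr dotZr hx mulr1 /beta dotC subrr.
have hg : g = h - beta *: x by rewrite /h addrK.
clearbody h beta.
have h0 : h = 0.
  apply/eqP; rewrite -dot_eq0 -sqrf_eq0 -oppr_eq0 eq_le oppr_le0 sqr_ge0 /=.
  apply: (@poly3_ge0_at0 R _ (dot h (Q *m h) + beta * dot h h)
    (2 * dot h (Q *m x) - dot h h) (dot x (Q *m x) + beta)) => t t0.
  have := hrefl (h + t *: x).
  have -> : dot x (h + t *: x) = t by rewrite dotDr dotZr hx hxh; ring.
  have -> : dot g (h + t *: x) = dot h h - t * beta.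
    by rewrite hg !(dotDr, dotDl, dotNl, dotZl, dotZr) hx (dotC h x) hxh; ring.
  rewrite mulmxDr -scalemxAr !(dotDr, dotDl, dotZl, dotZr) hx (dotC h x) hxh.
  rewrite (dot_mulmx_sym x h hQ) => hpos.
  by rewrite -(pmulr_rge0 _ t0); move: hpos; congr (0 <= _); ring.
exists beta; first by rewrite hg h0 add0r scaleNr.
have hq w : 0 <= dot x w ^+ 2 * (dot w (Q *m w) + beta * dot w w).
  have := hrefl w; rewrite hg h0 add0r dotNl dotZl.
  by congr (0 <= _); ring.
move=> w; have [xw|xw] := eqVneq (dot x w) 0; last first.
  by have := hq w; rewrite pmulr_rge0 // exprn_even_gt0.
apply: (@poly3_ge0_at0 R _ (2 * dot w (Q *m x))
   (dot x (Q *m x) + beta) 0) => t t0.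
have := hq (w + t *: x).
rewrite mulmxDr -scalemxAr !(dotDr, dotDl, dotZl, dotZr) hx (dotC w x) xw.
rewrite (dot_mulmx_sym x w hQ) add0r mulr1 pmulr_rge0; last exact: exprn_gt0.
by congr (0 <= _); ring.
Qed.

End NecessaryConditions.

(** Both u and e lie in the kernel of Q + beta I, so reflecting x along
    w = u + t e changes neither f nor the norm.  Since x^T w = t x^T e, the
    reflected point differs from x for t > 0 and tends to x as t -> 0. *)
Lemma not_strict_local_minimizer (R : realType) (n : nat)
    (Q : 'M[R]_n.+1) (b x u e : 'cV[R]_n.+1) (z beta : R) :
    Q^T = Q -> Q *m x + z *: b = - beta *: x -> dot x x = 1 -> z ^+ 2 = 1 ->
    Q *m u = - beta *: u -> Q *m e = - beta *: e ->
    u != 0 -> dot x u = 0 -> dot x e != 0 ->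
  ~ strict_local_minimizer (@tr_feasible R n.+1) (tr_objective Q b) (x, z).
Proof.
move=> hQ hw hx hz hu he u0 xu xe [_ hloc].
pose w (t : R) := u + t *: e.
pose c (t : R) := - 2 * (dot x (w t) / dot (w t) (w t)).
have xw t : dot x (w t) = t * dot x e by rewrite dotDr dotZr xu add0r.
have ww t : dot (w t) (w t) = dot u u + t * (2 * dot u e) + t * (t * dot e e).
  by rewrite !(dotDl, dotDr, dotZl, dotZr) (dotC e u); ring.
have cvgw : w t @[t --> (0 : R)] --> u.
  rewrite -[X in _ --> X]addr0 -(scale0r e).
  by apply: cvgD; [exact: cvg_cst|apply: cvgZl; exact: cvg_id].
have cvgl (a : R) : t * a @[t --> (0 : R)] --> (0 : R).
  rewrite -[X in _ --> X](mul0r a).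
  by apply: cvgM; [exact: cvg_id|exact: cvg_cst].
have cvgn : dot x (w t) @[t --> (0 : R)] --> (0 : R).
  by under eq_fun do rewrite xw; exact: cvgl.
have cvgd : dot (w t) (w t) @[t --> (0 : R)] --> dot u u.
  rewrite -[X in _ --> X]addr0 -[X in X + _]addr0 -[X in _ + _ + X](mul0r 0).
  under eq_fun do rewrite ww.
  apply: cvgD; last by apply: cvgM; [exact: cvg_id|exact: cvgl].
  by apply: cvgD; [exact: cvg_cst|exact: cvgl].
have cvgc : c t @[t --> (0 : R)] --> (0 : R).
  rewrite -[X in _ --> X](mulr0 (- 2)) -[X in - 2 * X](mul0r (dot u u)^-1).
  apply: cvgM; first exact: cvg_cst.
  by apply: cvgM => //; apply: cvgV => //; rewrite dot_eq0.
have cvgr : reflection x (w t) @[t --> (0 : R)] --> x.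
  rewrite -[X in _ --> X]addr0 -[X in _ + X](scale0r u).
  by apply: cvgD; [exact: cvg_cst|exact: cvgZ].
have cvgp : (reflection x (w t), z) @[t --> (0 : R)^'+] --> (x, z).
  apply: cvg_at_right_filter.
  by apply: (cvg_pair (G := nbhs x) (H := nbhs z)); [|exact: cvg_cst].
have : \forall t \near (0 : R)^'+, False; last by move/filter_ex => [? []].
near=> t.
have t0 : 0 < t by near: t; exact: nbhs_right_gt.
have xwt : dot x (w t) != 0 by rewrite xw mulf_neq0 // gt_eqF.
have w0 : w t != 0 by apply: contra_neq xwt => ->; rewrite dot0r.
have : tr_objective Q b (x, z) < tr_objective Q b (reflection x (w t), z).
  have hnear : tr_feasible (reflection x (w t), z) ->
    (reflection x (w t), z) <> (x, z) ->
    tr_objective Q b (x, z) < tr_objective Q b (reflection x (w t), z).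
    by near: t; exact: (cvgp _ hloc).
  apply: hnear; first by split => //=; rewrite dot_reflection // hx.
  move=> [] /eqP; rewrite /reflection -subr_eq0 addrAC subrr add0r.
  rewrite scaler_eq0 (negPf w0) orbF !mulf_eq0 invr_eq0 dot_eq0.
  by rewrite (negPf w0) (negPf xwt) oppr_eq0 pnatr_eq0.
have Qw : Q *m w t = - beta *: w t.
  by rewrite /w mulmxDr -scalemxAr hu he scalerDr !scalerA mulrC.
rewrite (tr_objectiveD_multiplier _ hQ hw) -/(reflection x (w t)).
rewrite dot_reflection // subrr mulr0 addr0 -scalemxAr Qw.
by rewrite !(dotZl, dotZr); lra.
Unshelve. all: by end_near.
Qed.

(** * Coordinates in the eigenbasis *)

Section Spectral.
Context (R : realType) (n : nat).
Variables (Q U : 'M[R]_n) (lam : 'rV[R]_n).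
Hypotheses (hU : U^T *m U = 1%:M) (hdec : Q = U *m diag_mx lam *m U^T).
Implicit Types (v w : 'cV[R]_n).

Local Notation coord j v := (dot (col j U) v).

Lemma coordE j v : coord j v = (U^T *m v) j 0.
Proof. by rewrite dotE !mxE; apply: eq_bigr => k _; rewrite !mxE. Qed.

Lemma dot_coord v w : dot v w = \sum_j coord j v * coord j w.
Proof.
have -> : dot v w = dot (U^T *m v) (U^T *m w).
  by rewrite /dot trmx_mul trmxK -mulmxA (mulmxA U) (mulmx1C hU) mul1mx.
by rewrite dotE; apply: eq_bigr => j _; rewrite !coordE.
Qed.

Lemma coord_inj v w : (forall j, coord j v = coord j w) -> v = w.
Proof.
move=> h; rewrite -[v]mul1mx -[w]mul1mx -(mulmx1C hU) -!mulmxA; congr mulmx.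
by apply/matrixP => j k; rewrite (ord1 k) -!coordE.
Qed.

Lemma coord_mulmx j v : coord j (Q *m v) = lam 0 j * coord j v.
Proof.
by rewrite !coordE hdec !mulmxA hU mul1mx -mulmxA mul_diag_mx mxE.
Qed.

Lemma coord_col i j : coord j (col i U) = (j == i)%:R.
Proof. by rewrite coordE colE mulmxA hU mul1mx mxE eqxx andbT. Qed.

Lemma mulmx_col i : Q *m col i U = lam 0 i *: col i U.
Proof.
apply: coord_inj => j; rewrite coord_mulmx dotZr coord_col.
by case: eqVneq => [->//|_]; rewrite !mulr0.
Qed.

Lemma shifted_form_coord v beta : dot v (Q *m v) + beta * dot v v =
  \sum_j (lam 0 j + beta) * coord j v ^+ 2.
Proof.
rewrite !dot_coord mulr_sumr -big_split; apply: eq_bigr => j _ /=.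
by rewrite coord_mulmx; ring.
Qed.

(** In the eigenbasis the form is a sum of nonnegative terms, so where it
    vanishes every coordinate with a positive weight is zero. *)
Lemma shifted_form_eigen v beta : (forall j, 0 <= lam 0 j + beta) ->
  dot v (Q *m v) + beta * dot v v <= 0 -> Q *m v = - beta *: v.
Proof.
move=> hpos; rewrite shifted_form_coord => hle.
have hterm j : 0 <= (lam 0 j + beta) * coord j v ^+ 2.
  by rewrite mulr_ge0 // sqr_ge0.
have : \sum_j (lam 0 j + beta) * coord j v ^+ 2 == 0.
  by rewrite eq_le hle sumr_ge0.
rewrite psumr_eq0 // => /allP h0; apply: coord_inj => j.
have := h0 j (mem_index_enum j); rewrite coord_mulmx dotZr /=.
rewrite mulf_eq0 sqrf_eq0 => /orP[|/eqP ->]; last by rewrite !mulr0.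
by rewrite addr_eq0 => /eqP ->.
Qed.

End Spectral.

(** * Characterization of the degenerate strict minimizers *)

Theorem theorem5p1 (R : realType) (n m : nat)
    (Q U : 'M[R]_n.+1) (b : 'cV[R]_n.+1) (lam : 'rV[R]_n.+1)
    (hm : (0 < m <= n.+1)%N)
    (hQ : Q^T = Q)
    (hU : U^T *m U = 1%:M)
    (hdec : Q = U *m diag_mx lam *m U^T)
    (hmono : forall i j : 'I_n.+1, (i <= j)%N -> lam 0 i <= lam 0 j)
    (hlow : forall i : 'I_n.+1, (i < m)%N -> lam 0 i = lam 0 ord0)
    (hgap : forall i : 'I_n.+1, (m <= i)%N -> lam 0 ord0 < lam 0 i)
    (hneg : lam 0 ord0 < 0) :
  (exists p : 'cV[R]_n.+1 * R,
      strict_global_minimizer (@tr_feasible R n.+1) (tr_objective Q b) p /\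
      ~ sosc Q b p)
  <->
  ((forall i : 'I_n.+1, (i < m)%N -> dot b (col i U) = 0) /\
   \sum_(j < n.+1 | (m <= j)%N)
      (dot (col j U) b / (lam 0 j - lam 0 ord0)) ^+ 2 = 1).
Proof.
have m0 : (0 < m)%N by case/andP: hm.
have hl j : 0 <= lam 0 j + - lam 0 ord0 by rewrite subr_ge0 hmono.
split=> [[[x z] [[hmin hloc] hns]]|[hb0 hb1]]; last first.
  (* The solution of (Q - l I) y = - b orthogonal to the lowest eigenspace. *)
  pose y : 'cV[R]_n.+1 := U *m \col_j (if (m <= j)%N
    then - (dot (col j U) b / (lam 0 j - lam 0 ord0)) else 0).
  have hy j : dot (col j U) y = if (m <= j)%N
      then - (dot (col j U) b / (lam 0 j - lam 0 ord0)) else 0.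
    by rewrite coordE /y mulmxA hU mul1mx mxE.
  have hyy : dot y y = 1.
    rewrite (dot_coord hU) -hb1 [RHS]big_mkcond; apply: eq_bigr => j _ /=.
    by rewrite hy; case: ifP => _; rewrite ?mul0r // mulrNN expr2.
  have hQy : Q *m y + 1 *: b = - (- lam 0 ord0) *: y.
    apply: (coord_inj hU) => j.
    rewrite scale1r dotDr dotZr (coord_mulmx hU hdec) hy opprK.
    case: ltnP => [jm|mj]; first by rewrite [dot _ b]dotC hb0 // !mulr0 addr0.
    have := hgap j mj; rewrite -subr_gt0 => /lt0r_neq0 hne.
    by field.
  (* A feasible (x, z) has the value of (z x, 1), which is compared with
     (y, 1) through d = z x - y. *)
  have hval q : tr_feasible q -> exists2 d,
      q.1 = q.2 *: (y + d) &
      tr_objective Q b q = tr_objective Q b (y, 1) +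
        (dot d (Q *m d) + - lam 0 ord0 * dot d d) +
        - lam 0 ord0 * (1 - dot (y + d) (y + d)).
    case: q => x z [/= hx hz]; exists (z *: x - y).
      by rewrite addrC subrK scalerA -expr2 hz scale1r.
    have := tr_objectiveD_multiplier (z *: x - y) hQ hQy.
    rewrite addrC subrK hyy => <-.
    have /orP[/eqP ->|/eqP ->] : (z == 1) || (z == -1).
    + by rewrite -sqrf_eq1 hz.
    + by rewrite scale1r.
    + by rewrite -tr_objectiveN opprK scaleN1r.
  have hdot q d : tr_feasible q -> q.1 = q.2 *: (y + d) ->
      dot (y + d) (y + d) <= 1.
    case: q => x z [/= hx hz] hxd; move: hx; rewrite hxd.
    by rewrite dotZl dotZr mulrA -expr2 hz mul1r.
  have hpsd d : 0 <= dot d (Q *m d) + - lam 0 ord0 * dot d d.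
    by rewrite (shifted_form_coord hU hdec) sumr_ge0 // => j _;
      rewrite mulr_ge0 // sqr_ge0.
  have hfy : tr_feasible (y, 1 : R) by split; rewrite /= ?hyy ?expr1n.
  exists (y, 1); split; last first.
    move/(soscP Q b y (expr1n _ 2)) => [_ [beta [hbeta hw hpos]]].
    (* A nonzero y admits at most one multiplier. *)
    have hbl : beta = - lam 0 ord0.
      have : (beta - - lam 0 ord0) *: y = 0.
        by rewrite scalerBl -[beta]opprK scaleNr -hw hQy !scaleNr !opprK addNr.
      move/eqP; rewrite scaler_eq0 -dot_eq0 hyy oner_eq0 orbF subr_eq0.
      by move/eqP.
    have h00 : dot (col ord0 U) (col ord0 U) = 1 by rewrite (coord_col hU) eqxx.
    have := hpos (col ord0 U).
    rewrite -dot_eq0 h00 oner_eq0 hy leqNgt m0 /= => /(_ isT erefl).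
    by rewrite hbl (mulmx_col hU hdec) dotZr h00 !mulr1 subrr ltxx.
  split; split=> //.
    move=> q hq; have [d hqd ->] := hval q hq.
    by have := hdot q d hq hqd; have := hpsd d; nra.
  (* Near (y, 1) the feasible points have z = 1. *)
  have hpos : \forall q \near ((y, 1) : 'cV[R]_n.+1 * R), 0 < q.2.
    exact: (cvgr_gt (1 : R) (@cvg_snd _ _ (nbhs y) (nbhs (1 : R)) _) 0 ltr01).
  near=> q => hq hqy.
  have q20 : 0 < q.2 by near: q.
  have q21 : q.2 = 1.
    case: hq => _ /eqP; rewrite sqrf_eq1 => /orP[/eqP //|/eqP q2].
    by move: q20; rewrite q2 oppr_gt0 ltr10.
  have [d hqd hobj] := hval q hq; have hd1 := hdot q d hq hqd.
  rewrite ltNge; apply/negP; rewrite hobj => hle.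
  have hd2 := hpsd d.
  have hd3 : dot (y + d) (y + d) = 1 by nra.
  have hQd : Q *m d = - - lam 0 ord0 *: d.
    by apply: (shifted_form_eigen hU hdec) => //; nra.
  have hyd : dot y d = 0.
    rewrite (dot_coord hU) big1 // => j _; rewrite hy; case: ifP => mj.
      have := congr1 (fun v => dot (col j U) v) hQd.
      rewrite (coord_mulmx hU hdec) dotZr opprK => /eqP.
      rewrite -subr_eq0 -mulrBl mulf_eq0 subr_eq0 gt_eqF ?hgap //=.
      by move/eqP ->; rewrite mulr0.
    by rewrite mul0r.
  have d0 : d = 0.
    apply/eqP; rewrite -dot_eq0; apply/eqP.
    move: hd3; rewrite !(dotDl, dotDr) hyy (dotC d y) hyd; lra.
  by apply: hqy; rewrite [q]surjective_pairing hqd q21 d0 addr0 scale1r.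
have [[_ /= hz] _] := hmin.
have h00 : dot (col ord0 U) (col ord0 U) = 1 by rewrite (coord_col hU) eqxx.
have hx := global_minimizer_on_sphere hQ hmin hneg h00 (mulmx_col hU hdec ord0).
have [beta hw hpsd] := multiplier_exists hQ hmin hx.
have hbl : 0 <= lam 0 ord0 + beta.
  have := hpsd (col ord0 U).
  by rewrite (mulmx_col hU hdec) dotZr h00 !mulr1.
have hbj j : 0 <= lam 0 j + beta.
  by apply: le_trans hbl _; rewrite lerD2r hmono.
have beta0 : 0 < beta by lra.
have heig u : dot u (Q *m u) + beta * dot u u <= 0 -> Q *m u = - beta *: u.
  exact: (shifted_form_eigen hU hdec).
have [u u0 [ux hu]] : exists2 u, u != 0 & dot u x = 0 /\ Q *m u = - beta *: u.
  apply: contrapT => hno; apply: hns; apply/(soscP Q b x hz); split=> //.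
  exists beta; split=> // u u0 ux; rewrite ltNge; apply/negP => /heig hu.
  by apply: hno; exists u.
(* If beta > - l then Q + beta I is definite and u = 0. *)
have hbeta : beta = - lam 0 ord0.
  apply/eqP; rewrite -addr_eq0 addrC eq_le hbl andbT leNgt; apply/negP => hlt.
  case/negP: u0; apply/eqP; apply: (coord_inj hU) => j.
  have := congr1 (fun v => dot (col j U) v) hu.
  rewrite (coord_mulmx hU hdec) dotZr dot0r => /eqP.
  rewrite -subr_eq0 -mulrBl mulf_eq0 opprK gt_eqF /= => [/eqP//|].
  by apply: lt_le_trans hlt _; rewrite lerD2r hmono.
have hxj (j : 'I_n.+1) : (j < m)%N -> dot (col j U) x = 0.
  move=> jm; apply/eqP; apply: contrapT => /negP xj.
  have hj : Q *m col j U = - beta *: col j U.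
    by rewrite (mulmx_col hU hdec) hlow // hbeta opprK.
  by apply: (not_strict_local_minimizer hQ hw hx hz hu hj u0 _ _ hloc);
    rewrite dotC.
have hcoord j : z * dot (col j U) b = (lam 0 ord0 - lam 0 j) * dot (col j U) x.
  have := congr1 (fun v => dot (col j U) v) hw.
  by rewrite dotDr !dotZr (coord_mulmx hU hdec) hbeta opprK => h; lra.
have zn0 : z != 0 by rewrite -sqrf_eq0 hz oner_eq0.
split=> [i im|].
  rewrite dotC; apply/eqP; have := hcoord i.
  by rewrite hxj // mulr0 => /eqP; rewrite mulf_eq0 (negPf zn0).
rewrite -hx (dot_coord hU) big_mkcond; apply: eq_bigr => j _ /=.
case: leqP => [mj|jm]; last by rewrite hxj // mul0r.
have := hgap j mj; rewrite -subr_gt0 => /lt0r_neq0 hne.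
by rewrite -[LHS]mul1r -hz -exprMn mulrA hcoord; field.
Unshelve. all: by end_near.
Qed.
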